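(* (Stone-Weierstrass for Nachbin spaces.) Let $(A,\prec)\in\mathbf{nbal}$. Then $\phi_A[\mathscr R(A,\prec)]$ is uniformly dense in $C_\le(X_A)$.
   Context: All rings are commutative with $1$ and ring homomorphisms are unital. An $\ell$-ring is a ring $A$ with a lattice order such that $a\le b$ implies $a+c\le b+c$, and $0\le a,b$ implies $0\le ab$. It is bounded if for each $a$ there is $n\in\mathbb N$ with $-n\cdot1\le a\le n\cdot1$, and archimedean if whenever $na\le b$ for all $n\in\mathbb N$, then $a\le0$. An $\ell$-algebra is an $\ell$-ring that is an $\mathbb R$-algebra with $ra\ge0$ whenever $0\le a\in A$ and $0\le r\in\mathbb R$. $\mathbf{bal}$ is the category of bounded archimedean $\ell$-algebras and unital $\ell$-algebra homomorphisms; $r\in\mathbb R$ is identified with $r\cdot1\in A$. Put $|a|=a\vee(-a)$ and $\|a\|=\inf\{r\in\mathbb R:|a|\le r\}$ (the uniform norm). $\mathbb R^+=[0,\infty)$. A reflexive proximity on $A\in\mathbf{bal}$ is a binary relation $\prec$ such that: (P1) $a\prec b$ implies $a\le b$; (P2) $a\le b\prec c\le d$ implies $a\prec d$; (P3) $a\prec b,c$ implies $a\prec b\wedge c$; (P4) $a,b\prec c$ implies $a\vee b\prec c$; (RP5) $a\prec b$ implies there is $c$ with $a\prec c\prec c\prec b$; (P6) $a\prec b$ and $c\prec d$ imply $a+c\prec b+d$; (P7) if $0\le a,b,c,d$, $a\prec b$ and $c\prec d$, then $ac\prec bd$; (P8) $r\prec r$ for $r\in\mathbb R$; (P9) $a\prec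 b$ and $r\in\mathbb R^+$ imply $ra\prec rb$. Put $\mathscr R(A,\prec)=\{c\in A:c\prec c\}$. $\mathbf{nbal}$ consists of the pairs $(A,\prec)$ with $A\in\mathbf{bal}$ and $\prec$ a reflexive proximity on $A$ such that $\{c-d:c,d\in\mathscr R(A,\prec)\}$ (the $\mathbf{bal}$-subalgebra generated by $\mathscr R(A,\prec)$) is uniformly dense in $A$. An ideal $I$ of $A$ is an $\ell$-ideal if $|a|\le|b|$, $b\in I$ imply $a\in I$. $X_A$ is the space of maximal $\ell$-ideals of $A$, with closed sets $\{x\in X_A:I\subseteq x\}$ for $I$ an $\ell$-ideal; it is compact Hausdorff. For $y\in X_A$ let ${\Downarrow}y=\{a\in A:\exists c\in y\cap\mathscr R(A,\prec),\ c\ge0,\ |a|\le c\}$ and define a partial order on $X_A$ by $x\le y\iff{\Downarrow}y\subseteq x$. $C(X_A)$ is the algebra of continuous real-valued functions with the sup norm, and $C_\le(X_A)$ is its subset of order-preserving functions. For $x\in X_A$ one has $A/x\cong\mathbb R$; $\phi_A:A\to C(X_A)$ is given by $\phi_A(a)(x)=r$, where $r$ is the unique real number with $a+x=r+x$. *)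

(* Defs.v *)
From HB Require Import structures.
From mathcomp Require Import all_boot all_order all_algebra.
From mathcomp Require Import all_classical all_reals all_analysis.
From mathcomp Require Import ring.
Import Order.TTheory GRing.Theory Num.Theory.
Import numFieldNormedType.Exports.

Set Implicit Arguments.
Unset Strict Implicit.
Unset Printing Implicit Defensive.
Set Warnings "-redundant-canonical-projection".

Local Open Scope classical_set_scope.
Local Open Scope ring_scope.

(* A commutative ring, a module over R and a lattice on one carrier, with no
   compatibility between them.  A packed record is used because
   Hierarchy-Builder refuses a structure that joins rings and lattices and is
   declared after realDomainType.  The zero ring is allowed, which the
   algebra structures of the library exclude. *)
Record lmodLatRing (R : realType) := LmodLatRing {
  llr_ring : comPzRingType;
  llr_lmod : GRing.Zmodule_isLmodule R llr_ring;
  llr_le : rel llr_ring;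
  llr_meet : llr_ring -> llr_ring -> llr_ring;
  llr_join : llr_ring -> llr_ring -> llr_ring;
  llr_lexx : reflexive llr_le;
  llr_le_anti : antisymmetric llr_le;
  llr_le_trans : transitive llr_le;
  llr_lexI : forall a b c, llr_le a (llr_meet b c) = llr_le a b && llr_le a c;
  llr_leUx : forall a b c, llr_le (llr_join a b) c = llr_le a c && llr_le b c
}.

Definition llr_sort (R : realType) (A : lmodLatRing R) : Type := llr_ring A.
Coercion llr_sort : lmodLatRing >-> Sortclass.

Section LmodLatRingInstances.
Variables (R : realType) (A : lmodLatRing R).

HB.instance Definition _ := GRing.ComPzRing.on (llr_sort A).
HB.instance Definition _ : GRing.Zmodule_isLmodule R (llr_sort A) := llr_lmod A.
HB.instance Definition _ :=
  Order.Le_isPOrder.Build ring_display (llr_sort A)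
    (@llr_lexx R A) (@llr_le_anti R A) (@llr_le_trans R A).
HB.instance Definition _ :=
  Order.POrder_MeetJoin_isLattice.Build ring_display (llr_sort A)
    (@llr_lexI R A) (@llr_leUx R A).

End LmodLatRingInstances.

Record is_lring (R : realType) (A : lmodLatRing R) : Prop := {
  lring_leD2r : forall a b c : A, a <= b -> a + c <= b + c;
  lring_mulr_ge0 : forall a b : A, 0 <= a -> 0 <= b -> 0 <= a * b
}.

Record is_lalgebra (R : realType) (A : lmodLatRing R) : Prop := {
  lalgebra_lring :> is_lring A;
  lalgebra_scalerAl : forall (r : R) (a b : A), r *: (a * b) = (r *: a) * b;
  lalgebra_scaler_ge0 : forall (r : R) (a : A), 0 <= a -> 0 <= r -> 0 <= r *: a
}.

Record is_bal (R : realType) (A : lmodLatRing R) : Prop := {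
  bal_lalgebra :> is_lalgebra A;
  bal_bounded : forall a : A, exists n : nat, - (n%:R : A) <= a /\ a <= n%:R;
  bal_archimedean : forall a b : A, (forall n : nat, a *+ n <= b) -> a <= 0
}.

Record bal (R : realType) := Bal {
  bal_llr :> lmodLatRing R;
  balP : is_bal bal_llr
}.

Definition of_real (R : realType) (A : lmodLatRing R) (r : R) : A :=
  r *: (1 : A).

Definition labs (R : realType) (A : lmodLatRing R) (a : A) : A :=
  Order.join a (- a).

Definition unif_norm (R : realType) (A : lmodLatRing R) (a : A) : R :=
  inf [set r : R | labs a <= of_real A r].

Definition sup_norm (R : realType) (X : Type) (f : X -> R) : R :=
  sup [set `|f x| | x in [set: X]].

Definition dense_in (R : realType) (V : zmodType) (N : V -> R)
    (T S : set V) : Prop :=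
  T `<=` S /\
  forall f, S f -> forall e : R, 0 < e -> exists2 g, T g & N (f - g) < e.

Record reflexive_proximity (R : realType) (A : bal R)
    (prec : A -> A -> Prop) : Prop := {
  prox_le : forall a b, prec a b -> a <= b;
  prox_trans : forall a b c d, a <= b -> prec b c -> c <= d -> prec a d;
  prox_meet : forall a b c, prec a b -> prec a c -> prec a (Order.meet b c);
  prox_join : forall a b c, prec a c -> prec b c -> prec (Order.join a b) c;
  prox_interp : forall a b, prec a b ->
    exists c, [/\ prec a c, prec c c & prec c b];
  prox_add : forall a b c d, prec a b -> prec c d -> prec (a + c) (b + d);
  prox_mul : forall a b c d, 0 <= a -> 0 <= b -> 0 <= c -> 0 <= d ->
    prec a b -> prec c d -> prec (a * c) (b * d);
  prox_const : forall r : R, prec (of_real A r) (of_real A r);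
  prox_scale : forall (r : R) a b, prec a b -> 0 <= r -> prec (r *: a) (r *: b)
}.

Definition reflexive_elts (R : realType) (A : bal R) (prec : A -> A -> Prop) :
    set A :=
  [set c | prec c c].

Record is_nbal (R : realType) (A : bal R) (prec : A -> A -> Prop) : Prop := {
  nbal_proximity : reflexive_proximity prec;
  nbal_dense : dense_in (@unif_norm R A)
    [set c - d | c in reflexive_elts prec & d in reflexive_elts prec] setT
}.

Record lideal (R : realType) (A : bal R) (I : set A) : Prop := {
  lideal0 : I 0;
  lidealD : forall a b, I a -> I b -> I (a + b);
  lidealM : forall a b, I b -> I (a * b);
  lideal_abs : forall a b, labs a <= labs b -> I b -> I a
}.

Definition maximal_lideal (R : realType) (A : bal R) (x : set A) : Prop :=
  [/\ lideal x, x <> setT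
    & forall J : set A, lideal J -> J <> setT -> x `<=` J -> J = x].

Record maxSpec (R : realType) (A : bal R) := MaxSpec {
  ms_ideal :> set A;
  ms_maximal : maximal_lideal ms_ideal
}.

Section MaxSpecTopology.
Variables (R : realType) (A : bal R).
Implicit Types (a b c d : A) (I J : set A) (x : maxSpec A).

HB.instance Definition _ := gen_eqMixin (maxSpec A).
HB.instance Definition _ := gen_choiceMixin (maxSpec A).

Definition hull I : set (maxSpec A) := [set x | I `<=` x].

Definition ms_open (U : set (maxSpec A)) : Prop :=
  exists2 I, lideal I & U = ~` hull I.

Let leD a b c d : a <= b -> c <= d -> a + c <= b + d.
Proof.
move=> ab cd; apply: (@le_trans _ _ (b + c)).
  exact: (lring_leD2r (balP A)).
by rewrite ![b + _]addrC; exact: (lring_leD2r (balP A)).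
Qed.

Let subge0 a b : (0 <= b - a) = (a <= b).
Proof.
apply/idP/idP => h.
  by have := leD h (lexx a); rewrite add0r subrK.
by have := leD h (lexx (- a)); rewrite subrr.
Qed.

Let halve a : 0 <= a + a -> 0 <= a.
Proof.
move=> h; have h2 : 0 <= 2^-1 :> R by rewrite invr_ge0.
have := lalgebra_scaler_ge0 (balP A) h h2.
by rewrite -mulr2n -[a *+ 2]scaler_nat scalerA mulVf ?pnatr_eq0// scale1r.
Qed.

Let mul0 a b : 0 <= a -> 0 <= b -> 0 <= a * b.
Proof. exact: (lring_mulr_ge0 (balP A)). Qed.

Let labs_le a b : (labs a <= b) = (a <= b) && (- a <= b).
Proof. exact: leUx. Qed.

Let le_labs a : a <= labs a.
Proof. by rewrite /labs leUl. Qed.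

Let leN_labs a : - a <= labs a.
Proof. by rewrite /labs leUr. Qed.

Let labs_ge0 a : 0 <= labs a.
Proof. by apply: halve; rewrite -(subrr a); apply: leD. Qed.

Let labsD a b : labs (a + b) <= labs a + labs b.
Proof. by rewrite labs_le opprD !leD. Qed.

Let labs_id a : 0 <= a -> labs a = a.
Proof.
move=> a0; apply/eqP; rewrite eq_le le_labs andbT labs_le lexx/= -subge0 opprK.
by rewrite -(addr0 0) leD.
Qed.

Let labsM a b : labs (a * b) <= labs a * labs b.
Proof.
have h c d (z := labs c * labs d - c * d) : 0 <= z.
  apply: halve; have -> : z + z = (labs c - c) * (labs d + d)
                                 + (labs c + c) * (labs d - d).
    by rewrite /z; ring.
  rewrite -(addr0 0); apply: leD; apply: mul0.
  - by rewrite subge0.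
  - by rewrite -[d in _ + d]opprK subge0.
  - by rewrite -[c in _ + c]opprK subge0.
  - by rewrite subge0.
rewrite labs_le -subge0 h/= -mulrN -subge0.
have := h a (- b).
by have -> : labs (- b) = labs b by rewrite /labs opprK joinC.
Qed.

Let ge0_1 : (0 : A) <= 1.
Proof.
have [n [lo hi]] := bal_bounded (balP A) 1.
case: n => [|n] in lo hi; first by rewrite oppr0 in lo.
have h : 0 <= (n.+1%:R : A).
  apply: halve; rewrite -[X in _ + X]opprK subge0.
  exact: le_trans lo hi.
have h2 : 0 <= n.+1%:R^-1 :> R by rewrite invr_ge0.
have := lalgebra_scaler_ge0 (balP A) h h2.
by rewrite -[n.+1%:R : A]scaler_nat scalerA mulVf ?pnatr_eq0// scale1r.
Qed.

Let lideal_labs I a : lideal I -> I (labs a) <-> I a.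
Proof.
by move=> hI; split; apply: (lideal_abs hI); rewrite [labs (labs a)]labs_id.
Qed.

Let lideal_eqT I : lideal I -> I 1 -> I = setT.
Proof.
by move=> hI I1; apply/seteqP; split => // a _; rewrite -(mulr1 a); exact: lidealM.
Qed.

Let maximal_unit x a : ~ ms_ideal x a ->
  exists w c, [/\ ms_ideal x w, 0 <= c & (1 : A) <= labs w + labs a * c].
Proof.
move=> xa; have [hx xT xmax] := ms_maximal x.
pose J : set A :=
  [set z | exists w c, [/\ ms_ideal x w, 0 <= c & labs z <= labs w + labs a * c]].
have hJ : lideal J.
  split.
  - exists 0, 0; split; [exact: lideal0|exact: lexx|].
    by rewrite mulr0 addr0.
  - move=> z1 z2 [w1 [c1 [xw1 c10 h1]]] [w2 [c2 [xw2 c20 h2]]].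
    exists (labs w1 + labs w2), (c1 + c2); split.
    + by apply: lidealD => //; apply/lideal_labs.
    + by rewrite -(addr0 0) leD.
    + rewrite [labs (labs w1 + _)]labs_id; last by rewrite -(addr0 0) leD.
      by rewrite mulrDr addrACA (le_trans (labsD _ _))// leD.
  - move=> d z [w [c [xw c0 h]]].
    exists (labs d * labs w), (labs d * c); split.
    + by apply: lidealM => //; apply/lideal_labs.
    + exact: mul0.
    + rewrite [labs (labs d * _)]labs_id; last exact: mul0.
      rewrite mulrCA -mulrDr (le_trans (labsM _ _))// -subge0 -mulrBr.
      by apply: mul0 => //; rewrite subge0.
  - move=> z1 z2 h [w [c [xw c0 h']]]; exists w, c; split => //.
    exact: le_trans h'.
have xJ : x `<=` J.
  move=> z xz; exists z, 0; split => //.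
  by rewrite mulr0 addr0.
have Ja : J a.
  exists 0, 1; split; [exact: lideal0|exact: ge0_1|].
  by rewrite mulr1 -[leLHS]add0r leD.
have [JT|/xmax /(_ xJ) Jx] := pselect (J = setT); last by rewrite Jx in Ja.
have [w [c [xw c0 h]]] : J 1 by rewrite JT.
by exists w, c; split => //; exact: le_trans h.
Qed.

Let lideal_setT : lideal [set: A].
Proof. by split. Qed.

Let ms_openT : ms_open setT.
Proof.
exists setT => //; apply/seteqP; split => // x _ /= h.
by have [_ xT _] := ms_maximal x; apply: xT; apply/seteqP; split.
Qed.

Let ms_openI : setI_closed ms_open.
Proof.
move=> _ _ [I hI ->] [J hJ ->]; exists (I `&` J).
  split.
  - by split; exact: lideal0.
  - by move=> a b [? ?] [? ?]; split; exact: lidealD.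
  - by move=> a b [? ?]; split; exact: lidealM.
  - by move=> a b ab [? ?]; split; apply: lideal_abs ab _.
apply/seteqP; split => x /=; last first.
  by move=> h; split=> h'; apply: h => a [Ia Ja]; exact: h'.
move=> [/existsNP[a /not_implyP[Ia xa]] /existsNP[b /not_implyP[Jb xb]]] h.
have [w [c [xw c0 hp]]] := maximal_unit xa.
have [v [d [xv d0 hq]]] := maximal_unit xb.
have [hx xT _] := ms_maximal x; apply: xT; apply: lideal_eqT => //.
set p := _ + _ in hp; set q := _ + _ in hq.
have xpq : ms_ideal x (p * q).
  have -> : p * q = q * labs w + labs a * c * labs v
                    + c * d * (labs a * labs b) by rewrite /p /q; ring.
  apply: lidealD => //; first apply: lidealD => //.
  - by apply: lidealM => //; apply/lideal_labs.
  - by apply: lidealM => //; apply/lideal_labs.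
  - apply: lidealM => //; apply: h; split.
      by rewrite mulrC; apply: lidealM => //; apply/lideal_labs.
    by apply: lidealM => //; apply/lideal_labs.
apply: lideal_abs xpq => //; rewrite labs_id ?ge0_1//.
apply: le_trans (le_labs _).
apply: (le_trans hq); rewrite -subge0 -[X in _ - X]mul1r -mulrBl.
by apply: mul0; rewrite ?subge0// (le_trans ge0_1).
Qed.

Let ms_open_bigU (K : Type) (f : K -> set (maxSpec A)) :
  (forall i, ms_open (f i)) -> ms_open (\bigcup_i f i).
Proof.
move=> /= hf; pose S : set A :=
  [set a | exists i I, [/\ lideal I, f i = ~` hull I & I a]].
pose G : set A := [set a | forall J, lideal J -> S `<=` J -> J a].
exists G.
  split.
  - by move=> J hJ _; exact: lideal0.
  - by move=> a b Ga Gb J hJ SJ; apply: lidealD => //; [exact: Ga|exact: Gb].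
  - by move=> a b Gb J hJ SJ; apply: lidealM => //; exact: Gb.
  - by move=> a b ab Gb J hJ SJ; apply: lideal_abs ab _ => //; exact: Gb.
apply/seteqP; split => x /=.
  move=> [i _]; have [I hI fi] := hf i; rewrite fi => h Gx; apply: h => a Ia.
  by apply: Gx => J _; apply; exists i, I.
move=> h; apply: contrapT => h'; apply: h => a; apply.
  by have [] := ms_maximal x.
move=> b [i [I [hI fi Ib]]]; apply: contrapT => xb; apply: h'.
by exists i => //; rewrite fi => /(_ _ Ib).
Qed.

HB.instance Definition _ :=
  isOpenTopological.Build (maxSpec A) ms_openT ms_openI ms_open_bigU.

End MaxSpecTopology.

Definition down_ideal (R : realType) (A : bal R) (prec : A -> A -> Prop)
    (y : set A) : set A :=
  [set a | exists c, [/\ y c, reflexive_elts prec c, 0 <= c & labs a <= c]].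

Definition ms_le (R : realType) (A : bal R) (prec : A -> A -> Prop)
    (x y : maxSpec A) : Prop :=
  down_ideal prec y `<=` x.

Definition order_preserving_continuous (R : realType) (A : bal R)
    (prec : A -> A -> Prop) : set (maxSpec A -> R) :=
  [set f | continuous f /\ forall x y, ms_le prec x y -> f x <= f y].

(* a + x = r + x means that a - r is in x; such an r exists and is unique for
   every maximal l-ideal x, so the default value 0 of xget is never taken. *)
Definition gelfand (R : realType) (A : bal R) (a : A) : maxSpec A -> R :=
  fun x => xget 0 [set r : R | ms_ideal x (a - of_real A r)].

(* Main.v *)
(* The quotient of A by a maximal l-ideal x is totally ordered and contains no
   infinitesimals, so it is R and a |-> gelfand a x is a homomorphism.  The
   space of maximal l-ideals is compact because along an ultrafilter the a with
   gelfand a --> 0 form a maximal l-ideal, which is the limit.  By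
   compactness, as in the lattice form of the Stone-Weierstrass theorem, it is
   enough to interpolate an order preserving f at two points x, y by a
   reflexive element.  If f x < f y then y <= x fails, which
   provides a reflexive c >= 0 vanishing at x and not at y, and a combination
   r + t c with t >= 0 interpolates. *)
Require Import Defs.
From mathcomp Require Import all_boot all_order all_algebra.
From mathcomp Require Import all_classical all_reals all_analysis.
From mathcomp Require Import ring lra.
Import Order.TTheory GRing.Theory Num.Theory.
Import numFieldNormedType.Exports.

Set Implicit Arguments.
Unset Strict Implicit.
Unset Printing Implicit Defensive.

Local Open Scope classical_set_scope.

(** * Order arithmetic in a bounded archimedean l-algebra *)

Section BalTheory.
Local Open Scope ring_scope.
Context {R : realType} {A : bal R}.
Implicit Types (a b c d : A) (r s : R).

Lemma bal_lerD a b c d : a <= b -> c <= d -> a + c <= b + d.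
Proof.
move=> ab cd; apply: (@le_trans _ _ (b + c)).
  exact: (lring_leD2r (balP A)).
by rewrite ![b + _]addrC; exact: (lring_leD2r (balP A)).
Qed.

Lemma bal_addr_ge0 a b : 0 <= a -> 0 <= b -> 0 <= a + b.
Proof. by move=> a0 b0; rewrite -(addr0 0) bal_lerD. Qed.

Lemma bal_subr_ge0 a b : (0 <= b - a) = (a <= b).
Proof.
apply/idP/idP => h.
  by have := bal_lerD h (lexx a); rewrite add0r subrK.
by have := bal_lerD h (lexx (- a)); rewrite subrr.
Qed.

Lemma bal_lerBlDr a b c : (a - b <= c) = (a <= c + b).
Proof. by rewrite -(bal_subr_ge0 (a - b)) -(bal_subr_ge0 a) opprB addrA addrAC. Qed.

Lemma bal_lerN2 a b : (- a <= - b) = (b <= a).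
Proof. by rewrite -(bal_subr_ge0 (- a)) -(bal_subr_ge0 b) opprK addrC. Qed.

Lemma bal_lerZ r a b : 0 <= r -> a <= b -> r *: a <= r *: b.
Proof.
move=> r0; rewrite -(bal_subr_ge0 a) -(bal_subr_ge0 (r *: a)) -scalerBr => h.
exact: (lalgebra_scaler_ge0 (balP A)).
Qed.

Lemma bal_lerM2r a b c : 0 <= c -> a <= b -> a * c <= b * c.
Proof.
move=> c0; rewrite -(bal_subr_ge0 a) -(bal_subr_ge0 (a * c)) -mulrBl => h.
exact: (lring_mulr_ge0 (balP A)).
Qed.

Lemma bal_halve a : 0 <= a + a -> 0 <= a.
Proof.
have h2 : 0 <= 2^-1 :> R by rewrite invr_ge0.
move=> /(bal_lerZ h2).
by rewrite scaler0 -mulr2n -[a *+ 2]scaler_nat scalerA mulVf ?pnatr_eq0// scale1r.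
Qed.

Lemma labs_le a b : (labs a <= b) = (a <= b) && (- a <= b).
Proof. exact: leUx. Qed.

Lemma ler_labs a : a <= labs a. Proof. by rewrite /labs leUl. Qed.

Lemma lerN_labs a : - a <= labs a. Proof. by rewrite /labs leUr. Qed.

Lemma labs_ge0 a : 0 <= labs a.
Proof.
by apply: bal_halve; rewrite -(subrr a) bal_lerD ?ler_labs ?lerN_labs.
Qed.

Lemma labs_id a : 0 <= a -> labs a = a.
Proof.
move=> a0; apply/eqP; rewrite eq_le ler_labs andbT labs_le lexx/=.
by rewrite -bal_subr_ge0 opprK bal_addr_ge0.
Qed.

Lemma labsD a b : labs (a + b) <= labs a + labs b.
Proof. by rewrite labs_le opprD !bal_lerD ?ler_labs ?lerN_labs. Qed.

(** Twice [|c||d| - cd] equals [(|c| - c)(|d| + d) + (|c| + c)(|d| - d)], a sum of products of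
    nonnegative factors. The bound on [- (a * b)] is the same fact for [a] and [- b]. *)
Lemma labsM a b : labs (a * b) <= labs a * labs b.
Proof.
have h c d : c * d <= labs c * labs d.
  rewrite -bal_subr_ge0; set z := _ - _.
  apply: bal_halve; have -> : z + z = (labs c - c) * (labs d + d)
                                 + (labs c + c) * (labs d - d).
    by rewrite /z; ring.
  apply: bal_addr_ge0; apply: (lring_mulr_ge0 (balP A)).
  - by rewrite bal_subr_ge0 ler_labs.
  - by rewrite -[d in _ + d]opprK bal_subr_ge0 lerN_labs.
  - by rewrite -[c in _ + c]opprK bal_subr_ge0 lerN_labs.
  - by rewrite bal_subr_ge0 ler_labs.
rewrite labs_le h/= -mulrN; have := h a (- b).
by have -> : labs (- b) = labs b by rewrite /labs opprK joinC.
Qed.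

Lemma bal_joinDr a b c : Order.join a b + c = Order.join (a + c) (b + c).
Proof.
apply/eqP; rewrite eq_le leUx !bal_lerD ?leUl ?leUr// !andbT.
rewrite -[c in X in X <= _]opprK bal_lerBlDr leUx.
by rewrite -!bal_lerBlDr opprK leUl leUr.
Qed.

Lemma bal_meetE a b : Order.meet a b = - Order.join (- a) (- b).
Proof.
have h c d e : (c <= - Order.join d e) = (c <= - d) && (c <= - e).
  by rewrite -(opprK c) !bal_lerN2 leUx.
apply/eqP; rewrite eq_le h !opprK leIl leIr/= lexI.
by have := h (- Order.join (- a) (- b)) (- a) (- b); rewrite !opprK lexx => <-.
Qed.

(** Boundedness gives [-n <= 1 <= n], hence [n + n >= 0]. If [n > 0], halving and dividing by [n]
    give the claim; if [n = 0], the lower bound is already the claim. *)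
Lemma bal_ler01 : (0 : A) <= 1.
Proof.
have [n [lo hi]] := bal_bounded (balP A) 1.
case: n => [|n] in lo hi; first by rewrite oppr0 in lo.
have h : 0 <= (n.+1%:R : A).
  apply: bal_halve; rewrite -[X in _ + X]opprK bal_subr_ge0.
  exact: le_trans lo hi.
have h2 : 0 <= n.+1%:R^-1 :> R by rewrite invr_ge0.
have := bal_lerZ h2 h.
by rewrite scaler0 -[n.+1%:R : A]scaler_nat scalerA mulVf ?pnatr_eq0// scale1r.
Qed.

Lemma of_realD r s : of_real A (r + s) = of_real A r + of_real A s.
Proof. exact: scalerDl. Qed.

Lemma of_realN r : of_real A (- r) = - of_real A r.
Proof. exact: scaleNr. Qed.

Lemma of_realB r s : of_real A (r - s) = of_real A r - of_real A s.
Proof. exact: scalerBl. Qed.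

Lemma scale_of_real r s : r *: of_real A s = of_real A (r * s).
Proof. exact: scalerA. Qed.

Lemma bal_scaleE r a : r *: a = of_real A r * a.
Proof. by rewrite -(lalgebra_scalerAl (balP A)) mul1r. Qed.

Lemma of_real_le r s : r <= s -> of_real A r <= of_real A s.
Proof.
rewrite -subr_ge0 -bal_subr_ge0 -of_realB => h.
by have := bal_lerZ h bal_ler01; rewrite scaler0.
Qed.

Lemma of_real_ge0 r : 0 <= r -> 0 <= of_real A r.
Proof. by move/of_real_le; rewrite {1}/of_real scale0r. Qed.

Lemma labs_bounded a : exists2 r : R, 0 < r & labs a <= of_real A r.
Proof.
have [n [lo hi]] := bal_bounded (balP A) a.
have e : of_real A n%:R = n%:R by rewrite /of_real scaler_nat.
(* Adding 1 keeps the bound strictly positive when [n = 0]. *)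
exists (n%:R + 1); first by rewrite ltr_wpDl.
apply: (@le_trans _ _ (of_real A n%:R)); last by apply: of_real_le; rewrite lerDl.
by rewrite e labs_le hi -bal_lerN2 opprK lo.
Qed.

(** Disjointness of the positive and negative parts: the negative part is [a^+ - a], so both [0] and
    [a] lie below [a^+ - c], hence so does [a^+]. *)
Lemma le_pos_neg_le0 a c :
  c <= Order.join a 0 -> c <= Order.join (- a) 0 -> c <= 0.
Proof.
move=> h1.
have -> : Order.join (- a) 0 = Order.join a 0 - a.
  by rewrite bal_joinDr subrr sub0r joinC.
rewrite -(bal_subr_ge0 c) addrAC bal_subr_ge0 => h2.
have : Order.join a 0 <= Order.join a 0 - c by rewrite leUx h2 bal_subr_ge0.
by rewrite -(bal_subr_ge0 _ (_ - c)) -(bal_subr_ge0 c) addrAC subrr.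
Qed.

End BalTheory.

(** * Residues at a maximal l-ideal and the Gelfand transform *)

Section Gelfand.
Local Open Scope ring_scope.
Context {R : realType} {A : bal R}.
Implicit Types (a b c d : A) (r s : R) (I : set A) (x : maxSpec A).

Lemma lideal_le I a b : lideal I -> 0 <= a -> a <= b -> I b -> I a.
Proof.
move=> hI a0 ab; apply: (lideal_abs hI).
by rewrite !labs_id// (le_trans a0).
Qed.

Lemma lideal_labs I a : lideal I -> I (labs a) <-> I a.
Proof.
by move=> hI; split; apply: (lideal_abs hI); rewrite (labs_id (labs_ge0 a)).
Qed.

Lemma lidealZ I r a : lideal I -> I a -> I (r *: a).
Proof. by move=> hI Ia; rewrite bal_scaleE; exact: lidealM. Qed.

Lemma lidealN I a : lideal I -> I a -> I (- a).
Proof. by move=> hI Ia; rewrite -scaleN1r; exact: lidealZ. Qed.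

Lemma lideal_eqT I : lideal I -> I 1 -> I = setT.
Proof.
by move=> hI I1; apply/seteqP; split => // a _; rewrite -(mulr1 a); exact: lidealM.
Qed.

Lemma lideal_of_real I r : lideal I -> r != 0 -> I (of_real A r) -> I = setT.
Proof.
move=> hI r0 /(lidealZ r^-1 hI); rewrite scale_of_real mulVf//.
by rewrite /of_real scale1r; exact: lideal_eqT.
Qed.

Lemma maxSpec_lideal x : lideal x.
Proof. by have [] := ms_maximal x. Qed.
Local Hint Resolve maxSpec_lideal : core.

Lemma maxSpec_of_real x r : ms_ideal x (of_real A r) -> r = 0.
Proof.
have [hx xT _] := ms_maximal x => xr; apply: contrapT => /eqP r0.
exact/xT/(lideal_of_real hx r0).
Qed.

(** The l-ideal [J] generated by [x] and [a] strictly contains [x], so by maximality it contains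
    1. *)
Lemma maxSpec_unit x a : 0 <= a -> ~ ms_ideal x a ->
  exists w r, [/\ ms_ideal x w, 0 < r & of_real A 1 <= w + r *: a].
Proof.
move=> a0 xa; have [hx xT xmax] := ms_maximal x.
pose J : set A :=
  [set z | exists w r, [/\ ms_ideal x w, 0 < r & labs z <= w + r *: a]].
have hJ : lideal J.
  split.
  - exists 0, 1; split => //; first exact: lideal0.
    by rewrite labs_id// add0r scale1r.
  - move=> z1 z2 [w1 [r1 [xw1 r10 h1]]] [w2 [r2 [xw2 r20 h2]]].
    exists (w1 + w2), (r1 + r2); split.
    + exact: lidealD.
    + by rewrite addr_gt0.
    + by rewrite scalerDl addrACA (le_trans (labsD _ _))// bal_lerD.
  (* Boundedness replaces the factor [d] by a real [s], so real coefficients of [a] are enough. *)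
  - move=> d z [w [r [xw r0 h]]]; have [s s0 ds] := labs_bounded d.
    exists (s *: w), (s * r); split; [exact: lidealZ|exact: mulr_gt0|].
    rewrite (le_trans (labsM _ _))// -scalerA -scalerDr.
    apply: (le_trans (bal_lerM2r (labs_ge0 z) ds)); rewrite -bal_scaleE.
    by apply: bal_lerZ => //; exact: ltW.
  - move=> z1 z2 h [w [r [xw r0 h']]]; exists w, r; split => //.
    exact: le_trans h'.
have xJ : x `<=` J.
  move=> z xz; exists (labs z), 1; split => //; first exact/lideal_labs.
  by rewrite scale1r -[X in X <= _]addr0 bal_lerD.
have Ja : J a.
  exists 0, 1; split; [exact: lideal0|by []|].
  by rewrite labs_id// scale1r add0r.
have [JT|/xmax /(_ xJ) Jx] := pselect (J = setT); last by rewrite Jx in Ja.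
have [w [r [xw r0 h]]] : J 1 by rewrite JT.
by exists w, r; split => //; rewrite /of_real scale1r (le_trans (ler_labs _)).
Qed.

(** This says that the quotient by [x] is totally ordered. If both parts of [a] were outside [x],
    both would dominate one positive real modulo [x], against their disjointness. *)
Lemma maxSpec_pos_neg x a :
  ms_ideal x (Order.join a 0) \/ ms_ideal x (Order.join (- a) 0).
Proof.
apply: contrapT => /not_orP[xu xv].
have [w1 [r1 [xw1 r10 h1]]] := maxSpec_unit (leUr _ _) xu.
have [w2 [r2 [xw2 r20 h2]]] := maxSpec_unit (leUr _ _) xv.
pose t := r1 + r2; have t0 : 0 < t by rewrite addr_gt0.
pose w := labs w1 + labs w2.
have xw : ms_ideal x w by apply: lidealD => //; exact/lideal_labs.
(* The common [w] and [t] give both parts the same lower bound, which is then at most 0; this forces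
   [1 <= w] with [w] in [x]. *)
have le_w d r w' : 0 <= d -> r <= t -> w' <= w ->
    of_real A 1 <= w' + r *: d -> t^-1 *: (of_real A 1 - w) <= d.
  move=> d0 rt w'w h.
  have -> : d = t^-1 *: (t *: d) by rewrite scalerA mulVf ?scale1r// gt_eqF.
  apply: bal_lerZ; first by rewrite invr_ge0 ltW.
  rewrite bal_lerBlDr addrC (le_trans h)// bal_lerD//.
  by rewrite -bal_subr_ge0 -scalerBl -(scaler0 _ (t - r)) bal_lerZ// subr_ge0.
have w1w : w1 <= w by rewrite -[w1]addr0 bal_lerD ?ler_labs ?labs_ge0.
have w2w : w2 <= w by rewrite -[w2]add0r bal_lerD ?ler_labs ?labs_ge0.
have r1t : r1 <= t by rewrite lerDl ltW.
have r2t : r2 <= t by rewrite lerDr ltW.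
have := le_pos_neg_le0 (le_w _ _ _ (leUr _ _) r1t w1w h1)
                       (le_w _ _ _ (leUr _ _) r2t w2w h2).
move=> /(bal_lerZ (ltW t0)).
rewrite scaler0 scalerA mulfV ?gt_eqF// scale1r bal_lerBlDr add0r => h.
have /maxSpec_of_real/eqP := lideal_le (maxSpec_lideal x) (of_real_ge0 ler01) h xw.
by rewrite oner_eq0.
Qed.

(** The hypothesis says that [a <= e] modulo [x] for every [e > 0]. If [a] were outside [x], then
    [1 <= w + r a] with [w] in [x], and a small enough [e] contradicts this. *)
Lemma maxSpec_infinitesimal x a : 0 <= a ->
  (forall e : R, 0 < e -> ms_ideal x (Order.join (a - of_real A e) 0)) ->
  ms_ideal x a.
Proof.
move=> a0 h; apply: contrapT => /(maxSpec_unit a0)[w [r [xw r0 hw]]].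
(* With this [e] one has [r e = 1/2], so [1/2 <= w + r b], an element of [x]. *)
have e0 : 0 < (2 * r)^-1 by rewrite invr_gt0 mulr_gt0.
have {}h := h _ e0; set b := Order.join _ _ in h.
have ab : a <= b + of_real A (2 * r)^-1 by rewrite -bal_lerBlDr leUl.
have xwb : ms_ideal x (w + r *: b) by apply: lidealD => //; exact: lidealZ.
have : of_real A 1 <= w + r *: b + of_real A 2^-1.
  apply: (le_trans hw); rewrite -addrA bal_lerD//.
  have -> : 2^-1 = r * (2 * r)^-1 by field; rewrite gt_eqF.
  by rewrite -scale_of_real -scalerDr bal_lerZ// ltW.
rewrite -bal_lerBlDr -of_realB => h2.
have q0 : 0 < 1 - 2^-1 :> R by lra.
have /maxSpec_of_real := lideal_le (maxSpec_lideal x) (of_real_ge0 (ltW q0)) h2 xwb.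
by move=> q; rewrite q ltxx in q0.
Qed.

(** A Dedekind cut: [S] is the set of reals that are at most [a] modulo [x], and its supremum is the
    residue. *)
Lemma maxSpec_residue x a : exists r, ms_ideal x (a - of_real A r).
Proof.
pose S := [set s | ms_ideal x (Order.join (of_real A s - a) 0)].
have [B B0] := labs_bounded a; rewrite labs_le => /andP[aB naB].
have S0 : S (- B).
  suff e : Order.join (of_real A (- B) - a) 0 = 0 by rewrite /S/= e; exact: lideal0.
  apply/eqP; rewrite eq_le leUr andbT leUx lexx andbT.
  by rewrite bal_lerBlDr add0r -bal_lerN2 of_realN opprK.
have SB : ubound S B.
  move=> s /= xs; rewrite leNgt; apply/negP => Bs.
  have /maxSpec_of_real/eqP : ms_ideal x (of_real A (s - B)).
    apply: lideal_le xs => //; first by rewrite of_real_ge0// subr_ge0 ltW.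
    by rewrite of_realB (le_trans _ (leUl _ _))// bal_lerD// bal_lerN2.
  by rewrite subr_eq0 gt_eqF.
have hS : has_sup S by split; [exists (- B)|exists B].
exists (sup S); apply/lideal_labs => //.
apply: maxSpec_infinitesimal; first exact: labs_ge0.
move=> e e0.
have [s Ss ses] := sup_adherent e0 hS.
have x1 : ms_ideal x (Order.join (of_real A (sup S - e) - a) 0).
  apply: lideal_le Ss; rewrite ?leUr// leUx leUr andbT.
  by rewrite (le_trans _ (leUl _ _))// bal_lerD// of_real_le// ltW.
(* By total order of the quotient, the alternative would put [sup S + e] into [S]. *)
have x2 : ms_ideal x (Order.join (a - of_real A (sup S + e)) 0).
  have [|] := maxSpec_pos_neg x (a - of_real A (sup S + e)); first by [].
  rewrite opprB => xS; have := ub_le_sup (ex_intro _ B SB) xS.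
  by rewrite leNgt ltrDl e0.
(* The positive part of [|a - sup S| - e] is at most the sum of the two elements found in [x]. *)
apply: lideal_le (lidealD (maxSpec_lideal x) x1 x2) => //.
  exact: leUr.
have p0 d : 0 <= Order.join d 0 by exact: leUr.
rewrite leUx bal_addr_ge0// andbT bal_lerBlDr labs_le; apply/andP; split.
  rewrite -bal_lerBlDr -[X in X <= _]add0r bal_lerD//.
  apply: le_trans _ (leUl _ _).
  by rewrite of_realD opprD addrA.
rewrite -bal_lerBlDr -[X in X <= _]addr0 bal_lerD//.
apply: le_trans _ (leUl _ _).
by rewrite of_realB opprB addrAC.
Qed.

Lemma gelfandP x a : ms_ideal x (a - of_real A (gelfand a x)).
Proof. by rewrite /gelfand; case: xgetP => // h; have [r /h] := maxSpec_residue x a. Qed.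

Lemma gelfand_eq x a r : ms_ideal x (a - of_real A r) -> gelfand a x = r.
Proof.
move=> h; apply/eqP; rewrite -subr_eq0; apply/eqP/(@maxSpec_of_real x).
rewrite of_realB (_ : _ - _ = (a - of_real A r) - (a - of_real A (gelfand a x))).
  by apply: lidealD => //; apply: lidealN => //; exact: gelfandP.
by ring.
Qed.

Lemma gelfand_eq0 x a : gelfand a x = 0 <-> ms_ideal x a.
Proof.
have e : a - of_real A 0 = a by rewrite /of_real scale0r subr0.
split=> [h|xa]; first by have := gelfandP x a; rewrite h e.
by apply: gelfand_eq; rewrite e.
Qed.

Lemma gelfand_of_real r x : gelfand (of_real A r) x = r.
Proof. by apply: gelfand_eq; rewrite subrr; exact: lideal0. Qed.

Lemma gelfand0 x : gelfand (0 : A) x = 0.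
Proof. by apply/gelfand_eq0; exact: lideal0. Qed.

Lemma gelfandD a b x : gelfand (a + b) x = gelfand a x + gelfand b x.
Proof.
apply: gelfand_eq; rewrite of_realD opprD addrACA.
by apply: lidealD => //; exact: gelfandP.
Qed.

Lemma gelfandZ r a x : gelfand (r *: a) x = r * gelfand a x.
Proof.
apply: gelfand_eq; rewrite -scale_of_real -scalerBr.
by apply: lidealZ => //; exact: gelfandP.
Qed.

Lemma gelfandN a x : gelfand (- a) x = - gelfand a x.
Proof. by rewrite -scaleN1r gelfandZ mulN1r. Qed.

Lemma gelfandB a b x : gelfand (a - b) x = gelfand a x - gelfand b x.
Proof. by rewrite gelfandD gelfandN. Qed.

Lemma gelfandM a b x : gelfand (a * b) x = gelfand a x * gelfand b x.
Proof.
apply: gelfand_eq; set r := gelfand a x; set s := gelfand b x.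
rewrite (_ : _ - _ = b * (a - of_real A r) + r *: (b - of_real A s)).
  apply: lidealD => //; first by apply: lidealM => //; exact: gelfandP.
  by apply: lidealZ => //; exact: gelfandP.
by rewrite scalerBr scale_of_real bal_scaleE; ring.
Qed.

Lemma gelfand_ge0 a x : 0 <= a -> 0 <= gelfand a x.
Proof.
move=> a0; rewrite leNgt; apply/negP => g0.
have /maxSpec_of_real/eqP : ms_ideal x (of_real A (- gelfand a x)).
  apply: (lideal_le _ _ _ (gelfandP x a)) => //.
    by rewrite of_real_ge0// oppr_ge0 ltW.
  by rewrite of_realN -[X in X <= _]add0r bal_lerD.
by rewrite oppr_eq0 lt_eqF.
Qed.

Lemma le_gelfand a b x : a <= b -> gelfand a x <= gelfand b x.
Proof. by rewrite -bal_subr_ge0 => /(gelfand_ge0 x); rewrite gelfandB subr_ge0. Qed.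

(** Writing the join as [(a - b)^+ + b], or symmetrically as [(b - a)^+ + a], reduces to the
    vanishing at [x] of one of the two positive parts. *)
Lemma gelfand_join a b x :
  gelfand (Order.join a b) x = Num.max (gelfand a x) (gelfand b x).
Proof.
have jE c d : Order.join c d = Order.join (c - d) 0 + d.
  by rewrite bal_joinDr subrK add0r.
have ha := le_gelfand x (leUl a b); have hb := le_gelfand x (leUr b a).
have [|] := maxSpec_pos_neg x (a - b) => /gelfand_eq0 h; apply/esym.
  move: ha; rewrite jE gelfandD h add0r => ha; exact/max_idPr.
by move: hb; rewrite joinC jE gelfandD -opprB h add0r => hb; exact/max_idPl.
Qed.

Lemma gelfand_meet a b x :
  gelfand (Order.meet a b) x = Num.min (gelfand a x) (gelfand b x).
Proof. by rewrite bal_meetE gelfandN gelfand_join !gelfandN oppr_max !opprK. Qed.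

Lemma gelfand_labs a x : gelfand (labs a) x = `|gelfand a x|.
Proof. by rewrite gelfand_join gelfandN maxrN. Qed.

End Gelfand.

(** * Topology and compactness of the space of maximal l-ideals *)

Section MaxSpecCompact.
Local Open Scope ring_scope.
Context {R : realType} {A : bal R}.
Implicit Types (a b c d : A) (r s : R) (I : set A) (x y : maxSpec A).

Lemma open_notin a : open [set x : maxSpec A | ~ ms_ideal x a].
Proof.
(* This is the l-ideal generated by [a]. *)
exists [set b | forall J, lideal J -> J a -> J b].
  split.
  - by move=> J hJ _; exact: lideal0.
  - by move=> b c Jb Jc J hJ Ja; apply: lidealD => //; [exact: Jb|exact: Jc].
  - by move=> b c Jc J hJ Ja; apply: lidealM => //; exact: Jc.
  - by move=> b c bc Jc J hJ Ja; apply: lideal_abs bc _ => //; exact: Jc.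
apply/seteqP; split => x /= xa h; apply: xa.
  by apply: h => J _.
by move=> b; apply => //; exact: maxSpec_lideal.
Qed.

Lemma gelfand_continuous a : continuous (gelfand a : maxSpec A -> R).
Proof.
move=> x; apply/(@cvgrPdist_lt _ _ _ (nbhs x) (nbhs_filter x)) => e e0.
(* A bump element: its transform is nonzero exactly where [gelfand a] is within [e] of its value at
   [x]. *)
pose b := Order.join (of_real A e - labs (a - of_real A (gelfand a x))) 0.
have bE y : gelfand b y = Num.max (e - `|gelfand a y - gelfand a x|) 0.
  by rewrite gelfand_join gelfandB gelfand_labs gelfandB !gelfand_of_real gelfand0.
have : nbhs x [set y | ~ ms_ideal y b].
  apply: open_nbhs_nbhs; split; first exact: open_notin.
  move=> /gelfand_eq0; rewrite bE subrr normr0 subr0 => /max_idPr.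
  by rewrite leNgt e0.
apply: filterS => y /= yb; rewrite distrC ltNge; apply/negP => h.
by apply: yb; apply/gelfand_eq0; rewrite bE; apply/max_idPr; rewrite subr_le0.
Qed.

Lemma gelfand_bounded a : exists M : R, forall x, `|gelfand a x| <= M.
Proof.
have [M _ aM] := labs_bounded a; exists M => x.
by rewrite -gelfand_labs -(gelfand_of_real (A := A) M x) le_gelfand.
Qed.

Lemma maxSpec_compact : compact [set: maxSpec A].
Proof.
rewrite compact_ultra => F FU _.
have FF : ProperFilter F by exact: ultra_proper.
(* The values lie in a compact segment, so the image of [F] clusters at some [r]; for an
   ultrafilter, clustering is convergence. *)
have cvgF a : exists r, gelfand a z @[z --> F] --> r.
  have [M aM] := gelfand_bounded a.
  have FM : (gelfand a @ F) [set` `[- M, M]].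
    by apply: (@filterS _ F _ setT) filterT => z _; rewrite /= in_itv/= -ler_norml.
  have [r [_ hr]] := segment_compact (fmap_proper_filter (gelfand a) FF) FM.
  exists r => U Ur; have [//|FU'] := in_ultra_setVsetC (gelfand a @^-1` U) FU.
  by have [t []] := hr (~` U) U FU' Ur.
pose I : set A := [set a | gelfand a z @[z --> F] --> (0 : R)].
have cvgE (f g : maxSpec A -> R) r :
    f =1 g -> g z @[z --> F] --> r -> f z @[z --> F] --> r by move=> /funext ->.
have I0 a r : gelfand a z @[z --> F] --> r -> I (a - of_real A r).
  move=> ar; apply: (cvgE _ (gelfand a - cst r)).
    by move=> z; rewrite gelfandB gelfand_of_real.
  by rewrite -(subrr r); apply: cvgB => //; exact: cvg_cst.
have hI : lideal I.
  split.
  - apply: (cvgE _ (cst 0)); first by move=> z; rewrite gelfand0.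
    exact: cvg_cst.
  - move=> a b Ia Ib; apply: (cvgE _ (gelfand a + gelfand b)).
      by move=> z; rewrite gelfandD.
    by rewrite -(addr0 0); exact: cvgD.
  - move=> a b Ib; have [r ar] := cvgF a.
    apply: (cvgE _ (gelfand a * gelfand b)); first by move=> z; rewrite gelfandM.
    by rewrite -(mulr0 r); exact: cvgM.
  - move=> a b ab /cvgr0Pnorm_lt Ib; apply/cvgr0Pnorm_lt => e e0.
    apply: filterS (Ib _ e0) => z; apply: le_lt_trans.
    by rewrite -!gelfand_labs le_gelfand.
have IT : I <> setT.
  move=> IT; have : I (of_real A 1) by rewrite IT.
  move=> /cvgr0Pnorm_lt/(_ _ ltr01)/filter_ex[z].
  by rewrite gelfand_of_real normr1 ltxx.
have maxI : maximal_lideal I.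
  split => // J hJ JT IJ; apply/seteqP; split => // a Ja.
  (* If the limit [r] were nonzero, then [a - r] in [I], hence in [J], would put the invertible real
     [r] into [J]. *)
  have [r ar] := cvgF a.
  have [r0|r0] := eqVneq r 0; first by rewrite r0 in ar.
  exfalso; apply/JT/(lideal_of_real hJ r0).
  rewrite -[of_real A r](subKr a); apply: lidealD => //.
  by apply: lidealN => //; apply/IJ/I0.
exists (MaxSpec maxI); split => // U; rewrite nbhsE => -[V [[K hK ->] /= KI]] VU.
apply: filterS VU _.
(* Some [a] in [K] has a nonzero limit along [F], so eventually [gelfand a z] is nonzero and [z]
   does not contain [K]. *)
move/existsNP : KI => [a /not_implyP[Ka Ia]].
have [r ar] := cvgF a.
have r0 : r != 0 by apply/eqP => r0; rewrite r0 in ar.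
have rp : 0 < `|r| by rewrite normr_gt0.
apply: (@filterS _ F _ _ _ _ (cvgr_dist_lt _ _ ar _ rp)) => z hz /(_ _ Ka)/gelfand_eq0 z0.
by move: hz; rewrite z0 subr0 ltxx.
Qed.

End MaxSpecCompact.

(** * Compactness for directed families *)

Section DirectedCovering.
Context {X : topologicalType} {T : Type}.

(* The filter generated by the down-sets of D replaces a finite subcover. *)
Lemma compact_directed_covering (D : set T) (le : T -> T -> Prop)
    (P : T -> X -> Prop) :
  compact [set: X] -> D !=set0 ->
  (forall t, le t t) -> (forall t u v, le t u -> le u v -> le t v) ->
  (forall t u, D t -> D u -> exists v, [/\ D v, le v t & le v u]) ->
  (forall t u x, le t u -> P u x -> P t x) ->
  (forall x : X, exists2 t, D t & \forall y \near x, P t y) ->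
  exists2 t, D t & forall x, P t x.
Proof.
move=> /compact_near_coveringP cX [t0 Dt0] lexx le_trans Ddir Pmono Pcov.
pose F : set_system T :=
  [set S | exists2 t, D t & [set u | D u /\ le u t] `<=` S].
have FF : Filter F.
  split.
  - by exists t0.
  - move=> S1 S2 [t1 Dt1 h1] [t2 Dt2 h2].
    have [v [Dv vt1 vt2]] := Ddir _ _ Dt1 Dt2.
    exists v => // u [Du uv]; split; first exact/h1/(conj Du)/(le_trans _ _ _ uv).
    exact/h2/(conj Du)/(le_trans _ _ _ uv).
  - by move=> S1 S2 S12 [t Dt h]; exists t => //; exact: subset_trans S12.
have [|t Dt h] := cX T F P FF.
  move=> x _; have [t Dt Pt] := Pcov x.
  exists ([set y | P t y] : set X, [set u | D u /\ le u t]) => /=.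
    by split=> //; exists t.
  by move=> [y u] /= [Pty [_ ut]]; exact: Pmono Pty.
by exists t => // x; exact: h.
Qed.

End DirectedCovering.

(** * The lattice form of the Stone-Weierstrass theorem *)

Section LatticeStoneWeierstrass.
Local Open Scope ring_scope.
Context {R : realType} {X : topologicalType}.
Implicit Types (f g h : X -> R) (L : set (X -> R)).

Lemma lattice_stone_weierstrass L f (e : R) :
  compact [set: X] -> L !=set0 ->
  (forall g h, L g -> L h -> L (g \min h)) ->
  (forall g h, L g -> L h -> L (g \max h)) ->
  (forall g, L g -> continuous g) -> continuous f ->
  (forall x y, exists g, [/\ L g, g x = f x & g y = f y]) ->
  0 < e -> exists2 g, L g & forall x, `|f x - g x| < e.
Proof.
move=> cX L0 Lmin Lmax Lc fc Lf e0.
have nearB g x : continuous g -> g x = f x -> \forall y \near x, `|f y - g y| < e.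
  move=> gc gx; have : (f - g) y @[y --> x] --> f x - g x.
    by apply: cvgB; [exact: fc|exact: gc].
  rewrite gx subrr => /(@cvgr0Pnorm_lt _ _ _ (nbhs x) (nbhs_filter x)).
  exact.
(* First stage: with [x] fixed, meets of interpolants keep the value at [x] and descend below
   [f + e] everywhere. *)
have upper x : exists g, [/\ L g, g x = f x & forall y, g y < f y + e].
  have [||||||g [Lg gx] gf] := @compact_directed_covering X (X -> R)
    [set g | L g /\ g x = f x] (fun g h => forall y, g y <= h y)
    (fun g y => g y < f y + e) cX; last by exists g.
  - by have [g [Lg gx _]] := Lf x x; exists g.
  - by [].
  - by move=> g h k gh hk y; exact: le_trans (hk y).
  - move=> g h [Lg gx] [Lh hx]; exists (g \min h); split.
    + by split; [exact: Lmin|rewrite /= gx hx minxx].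
    + by move=> y; rewrite /= ge_min lexx.
    + by move=> y; rewrite /= ge_min lexx orbT.
  - by move=> g h y gh; exact: le_lt_trans.
  - move=> y; have [g [Lg gx gy]] := Lf x y; exists g => //.
    apply: filterS (nearB g y (Lc _ Lg) gy) => z.
    by rewrite ltr_norml => /andP[h _]; lra.
(* Second stage: the order is reversed, so that joins of such functions rise above [f - e] while
   staying below [f + e]. *)
have [||||||g [Lg gu] gl] := @compact_directed_covering X (X -> R)
    [set g | L g /\ forall y, g y < f y + e] (fun g h => forall y, h y <= g y)
    (fun g y => f y - e < g y) cX.
(* On an empty space any member of [L] will do. *)
- have [[x _]|X0] := pselect (exists x : X, True); last first.
    by have [g Lg] := L0; exists g; split => // y; case: X0; exists y.
  by have [g [Lg _ gu]] := upper x; exists g.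
- by [].
- by move=> g h k gh hk y; exact: le_trans (gh y).
- move=> g h [Lg gu] [Lh hu]; exists (g \max h); split.
  + by split; [exact: Lmax|move=> y; rewrite /= gt_max gu hu].
  + by move=> y; rewrite /= le_max lexx.
  + by move=> y; rewrite /= le_max lexx orbT.
- by move=> g h y gh fh; exact: lt_le_trans (gh y).
- move=> y; have [g [Lg gy gu]] := upper y; exists g => //.
  apply: filterS (nearB g y (Lc _ Lg) gy) => z.
  by rewrite ltr_norml => /andP[_ h]; lra.
by exists g => // x; rewrite ltr_norml; have := gu x; have := gl x; lra.
Qed.

End LatticeStoneWeierstrass.

(** * Reflexive elements: monotonicity and two-point interpolation *)

Section ReflexiveElements.
Local Open Scope ring_scope.
Context {R : realType} {A : bal R} {prec : A -> A -> Prop}.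
Hypothesis hprec : reflexive_proximity prec.
Local Notation refl := (reflexive_elts prec).

Lemma reflexive_of_real (r : R) : refl (of_real A r).
Proof. exact: (prox_const hprec). Qed.

Lemma reflexiveD (a b : A) : refl a -> refl b -> refl (a + b).
Proof. exact: (prox_add hprec). Qed.

Lemma reflexiveZ (r : R) (a : A) : 0 <= r -> refl a -> refl (r *: a).
Proof. by move=> r0 ha; exact: (prox_scale hprec). Qed.

Lemma reflexive_join (a b : A) : refl a -> refl b -> refl (Order.join a b).
Proof.
move=> ha hb; apply: (prox_join hprec).
  exact: (prox_trans hprec (lexx a) ha (leUl _ _)).
exact: (prox_trans hprec (lexx b) hb (leUr _ _)).
Qed.

Lemma reflexive_meet (a b : A) : refl a -> refl b -> refl (Order.meet a b).
Proof.
move=> ha hb; apply: (prox_meet hprec).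
  exact: (prox_trans hprec (leIl _ _) ha (lexx a)).
exact: (prox_trans hprec (leIr _ _) hb (lexx b)).
Qed.

(** With [r] the value of [a] at [y], the element [(a - r)^+] is reflexive, nonnegative and in [y],
    so [x <= y] puts it into [x]. *)
Lemma gelfand_reflexive_mono (a : A) (x y : maxSpec A) :
  refl a -> ms_le prec x y -> gelfand a x <= gelfand a y.
Proof.
move=> ha xy; set r := gelfand a y.
pose c := Order.join (a - of_real A r) (of_real A 0).
have cE z : gelfand c z = Num.max (gelfand a z - r) 0.
  by rewrite gelfand_join gelfandB !gelfand_of_real.
have c0 : 0 <= c by rewrite /c {2}/of_real scale0r leUr.
have : ms_ideal x c.
  apply: xy; exists c; split => //; last by rewrite labs_id.
    by apply/gelfand_eq0; rewrite cE subrr maxxx.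
  apply: reflexive_join (reflexive_of_real 0).
  by rewrite -of_realN; apply: reflexiveD => //; exact: reflexive_of_real.
by move=> /gelfand_eq0; rewrite cE => /max_idPr; rewrite subr_le0.
Qed.

Lemma reflexive_separates (x y : maxSpec A) : ~ ms_le prec y x ->
  exists c, [/\ refl c, gelfand c x = 0 & 0 < gelfand c y].
Proof.
(* The witness is the reflexive bound [c] of some [a] in the down-ideal of [x] but outside [y]; [c]
   in [y] would force [a] in [y]. *)
move=> /existsNP[a /not_implyP[[c [xc hc c0 ac]] ya]].
exists c; split => //; first exact/gelfand_eq0.
rewrite lt_neqAle gelfand_ge0// andbT eq_sym; apply/eqP => /gelfand_eq0 yc.
by apply: ya; apply: (lideal_abs (maxSpec_lideal y)) yc; rewrite (labs_id c0).
Qed.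

Lemma reflexive_interpolation_le (x y : maxSpec A) (r s : R) :
  ~ ms_le prec y x -> r <= s ->
  exists c, [/\ refl c, gelfand c x = r & gelfand c y = s].
Proof.
move=> /reflexive_separates[c [hc cx cy]] rs.
(* The coefficient is nonnegative because [r <= s]; nonnegative scaling preserves reflexivity. *)
exists (of_real A r + ((s - r) / gelfand c y) *: c); split.
- apply: reflexiveD; first exact: reflexive_of_real.
  by apply: reflexiveZ => //; rewrite divr_ge0 ?subr_ge0// ltW.
- by rewrite gelfandD gelfandZ gelfand_of_real cx mulr0 addr0.
- by rewrite gelfandD gelfandZ gelfand_of_real divfK ?gt_eqF// addrC subrK.
Qed.

Lemma reflexive_interpolation (f : maxSpec A -> R) (x y : maxSpec A) :
  (forall x y, ms_le prec x y -> f x <= f y) ->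
  exists c, [/\ refl c, gelfand c x = f x & gelfand c y = f y].
Proof.
move=> fmono; case: (ltgtP (f x) (f y)) => fxy.
- apply: reflexive_interpolation_le (ltW fxy).
  by move=> /fmono; rewrite leNgt fxy.
- have xy : ~ ms_le prec x y by move=> /fmono; rewrite leNgt fxy.
  by have [c [hc cy cx]] := reflexive_interpolation_le xy (ltW fxy); exists c.
- exists (of_real A (f x)); rewrite !gelfand_of_real.
  by split => //; exact: reflexive_of_real.
Qed.

End ReflexiveElements.

(** * Uniform density *)

(** A supremum turns strict bounds into weak ones, so the margin [e / 2] restores strictness. For
    empty [X] the supremum is 0 by convention. *)
Lemma sup_norm_lt (R : realType) (X : Type) (f : X -> R) (e : R) :
  (0 < e)%R -> (forall x, `|f x| < e / 2)%R -> (sup_norm f < e)%R.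
Proof.
move=> e0 fe; apply: (@le_lt_trans _ _ (e / 2)%R); last by rewrite gtr_pMr// invf_lt1// ltr1n.
rewrite /sup_norm; have [->|S0] := eqVneq [set `|f x|%R | x in [set: X]] set0.
  by rewrite sup0 divr_ge0// ltW.
apply: ge_sup; first exact/set0P.
by move=> _ [x _ <-]; exact: ltW.
Qed.

Theorem theorem6p1 (R : realType) (A : bal R) (prec : A -> A -> Prop)
    (hA : is_nbal prec) :
  dense_in (@sup_norm R (maxSpec A))
    [set gelfand c | c in reflexive_elts prec]
    (order_preserving_continuous prec).
Proof.
have hprec := nbal_proximity hA.
split=> [_ [c hc <-]|f [fc fmono] e e0].
  by split=> [|x y]; [exact: gelfand_continuous|exact: gelfand_reflexive_mono].
have e2 : (0 < e / 2)%R by rewrite divr_gt0.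
have [|||||g Lg fg] := @lattice_stone_weierstrass R (maxSpec A)
  [set gelfand c | c in reflexive_elts prec] f _ (maxSpec_compact (A := A)) _ _ _ _ fc _ e2.
- by exists (gelfand (of_real A 0)), (of_real A 0) => //; exact: reflexive_of_real.
- move=> _ _ [a ha <-] [b hb <-]; exists (Order.meet a b).
    exact: reflexive_meet.
  by apply/funext => x; rewrite gelfand_meet.
- move=> _ _ [a ha <-] [b hb <-]; exists (Order.join a b).
    exact: reflexive_join.
  by apply/funext => x; rewrite gelfand_join.
- by move=> _ [a _ <-]; exact: gelfand_continuous.
- move=> x y; have [c [hc cx cy]] := reflexive_interpolation hprec x y fmono.
  by exists (gelfand c); split => //; exists c.
by exists g => //; exact: sup_norm_lt.
Qed.
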